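(* Let $(X,\mu)$ and $(Y,\nu)$ be good Cantor measure spaces with the same clopen values set, $S(\mu)=S(\nu)$. Then the set $\mathcal{CS}_{iso}((X,\mu),(Y,\nu))$ of Cantor measure space isomorphisms from $(X,\mu)$ to $(Y,\nu)$ is a dense $G_\delta$ subset of the completely metrizable space $\mathcal{CS}((X,\mu),(Y,\nu))$ of Cantor measure space maps from $(X,\mu)$ to $(Y,\nu)$. Thus the generic Cantor measure space map between them is invertible.
   Context: A Cantor space is a nonempty compact, metrizable, zero-dimensional space without isolated points. A Cantor measure space $(X,\mu)$ is a Cantor space $X$ with a finite, nonatomic Borel measure $\mu$ which is full (every nonempty open set has positive measure); nonatomic means that countable sets have measure zero. The clopen values set is $S(\mu)=\{\mu(A): A\text{ clopen in }X\}$. The measure $\mu$, and $(X,\mu)$, is called good when for all clopen $A,B\subset X$ with $\mu(A)\le\mu(B)$ there is a clopen $A_1\subset B$ with $\mu(A_1)=\mu(A)$. A Cantor measure space map $T:(X,\mu)\to(Y,\nu)$ is a continuous map with $\mu(T^{-1}(B))=\nu(B)$ for all Borel $B\subset Y$. It is an isomorphism when it is a homeomorphism (its inverse is then also measure preserving). $\mathcal{CS}((X,\mu),(Y,\nu))$ carries the topology of uniform convergence (sup metric). Generic means belonging to a residual set, i.e. one containing a dense $G_\delta$. *)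

(* Defs.v *)
From HB Require Import structures.
From mathcomp Require Import all_boot all_order all_algebra.
From mathcomp Require Import all_classical all_reals all_analysis.
From mathcomp Require Import borel_hierarchy.

Set Implicit Arguments.
Unset Strict Implicit.
Unset Printing Implicit Defensive.

Import Order.TTheory GRing.Theory Num.Theory.
Import numFieldTopology.Exports.

Local Open Scope classical_set_scope.
Local Open Scope ring_scope.

(* The base point makes the space nonempty; [measurableType] requires it. *)
#[short(type="pmetricType")]
HB.structure Definition PointedMetric (R : numDomainType) :=
  { T of Pointed T & Metric R T }.

Notation borel X := (g_sigma_algebraType (@open X)).

Section general_topology.

Definition homeomorphism (S T : topologicalType) (f : S -> T) :=
  continuous f /\
  exists g : T -> S, [/\ continuous g, cancel f g & cancel g f].

(* Completeness as in [Uniform_isComplete], but without requiring a base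
   point. *)
Definition complete (M : uniformType) :=
  forall F : set_system M, ProperFilter F -> cauchy F -> exists x : M, F --> x.

Definition completely_metrizable (R : realType) (T : topologicalType) :=
  exists M : metricType R,
    complete M /\ exists f : T -> M, homeomorphism f.

Definition dense_Gdelta (T : topologicalType) (A : set T) :=
  dense A /\ Gdelta A.

Definition residual (T : topologicalType) (A : set T) :=
  exists2 G : set T, dense_Gdelta G & G `<=` A.

End general_topology.

Section cantor_measure_space.
Context {R : realType}.

(* No measurability assumption on A: in a metric space every countable set is
   Borel. *)
Definition nonatomic (X : pmetricType R)
    (mu : {finite_measure set (borel X) -> \bar R}) :=
  forall A : set X, countable A -> mu A = 0%E.

Definition full (X : pmetricType R)
    (mu : {finite_measure set (borel X) -> \bar R}) :=
  forall U : set X, open U -> U !=set0 -> (0 < mu U)%E.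

Definition cantor_measure_space (X : pmetricType R)
    (mu : {finite_measure set (borel X) -> \bar R}) :=
  [/\ cantor_like X, nonatomic mu & full mu].

Definition clopen_values (X : pmetricType R)
    (mu : {finite_measure set (borel X) -> \bar R}) : set (\bar R) :=
  [set mu A | A in [set A : set X | clopen A]].

Definition good (X : pmetricType R)
    (mu : {finite_measure set (borel X) -> \bar R}) :=
  forall A B : set X, clopen A -> clopen B -> (mu A <= mu B)%E ->
    exists A1 : set X, [/\ clopen A1, A1 `<=` B & mu A1 = mu A].

End cantor_measure_space.

Section cantor_measure_space_maps.
Context {R : realType} (X Y : pmetricType R).
Variables (mu : {finite_measure set (borel X) -> \bar R})
          (nu : {finite_measure set (borel Y) -> \bar R}).

(* As a type, [CS] is a subspace of [{uniform X -> Y}], whose topology is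
   induced by the sup metric of the metric of Y. *)
Definition CS : set {uniform X -> Y} :=
  [set T | continuous (T : X -> Y) /\
    forall B : set (borel Y), measurable B ->
      mu ((T : X -> Y) @^-1` B) = nu B].

Definition CSiso : set CS :=
  [set T | homeomorphism (set_val T : X -> Y)].

End cantor_measure_space_maps.

Arguments CSiso {R X Y} mu nu _.

(* Main.v *)
Require Import Defs.
From HB Require Import structures.
From mathcomp Require Import all_boot all_order all_algebra.
From mathcomp Require Import all_classical all_reals all_analysis.
From mathcomp Require Import borel_hierarchy lra.

(**
The space of maps is complete for the sup metric of [Y] because a uniform limit
of measure preserving maps has, for each clopen [B], the same preimage of [B]
as the maps close to it, and clopen sets form a pi-system generating the Borel
sets.

Fullness of [nu] makes every Cantor measure space map surjective, so it is an
isomorphism as soon as it is injective; injectivity means that, for each of the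
countably many clopen sets [C], the images of [C] and of its complement are
disjoint, and by compactness this is an open condition.

For density, let [T] be a map and let [t] be a finite list of clopen sets of
[Y] whose atoms have small diameter. Their preimages under [T] form a list [s]
with the same measures of atoms. A back-and-forth argument, where goodness
together with [S(mu) = S(nu)] allows one to transfer one clopen set at a time,
extends the matching of [s] with [t] to all clopen sets, and hence to an
isomorphism, which stays in the same atoms as [T].
*)

Set Implicit Arguments.
Unset Strict Implicit.
Unset Printing Implicit Defensive.

Import Order.TTheory GRing.Theory Num.Theory.
Import numFieldTopology.Exports.

Local Open Scope classical_set_scope.
Local Open Scope ring_scope.

(** * Uniform neighbourhoods, compactness and clopen sets *)

Lemma nbhs_subtype_uniform (R : realType) (X : choiceType)
    (Y : pseudoMetricType R) (A : set {uniform X -> Y}) (T : A) (P : set A) :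
  nbhs T P <-> exists2 e : R, 0 < e &
    forall S : A, (forall x, ball (set_val T x) e (set_val S x)) -> P S.
Proof.
split.
  move=> [_ [[W oW <-] WT] sWP].
  have /uniform_nbhs[E [entE EW]] : nbhs (set_val T : {uniform X -> Y}) W.
    exact: open_nbhs_nbhs.
  move: entE; rewrite -entourage_ballE => -[e e0 eE].
  exists e => // S TS; apply: sWP => /=; apply: EW => x _; apply: eE; exact: TS.
move=> [e e0 eP].
have : nbhs (set_val T : {uniform X -> Y})
    [set h : {uniform X -> Y} | forall x, ball (set_val T x) e (h x)].
  apply/uniform_nbhs; exists [set xy | ball xy.1 e xy.2]; split.
    exact: (entourage_ball _ (PosNum e0)).
  by move=> h /= h_ x; exact: h_.
rewrite nbhsE => -[W [oW WT] Wh].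
exists (set_val @^-1` W); split; [by exists W|exact: WT|].
by move=> S WS; apply: eP; exact: Wh.
Qed.

(** Both [B] and its complement are open, so near each point some radius keeps balls on one side;
    compactness makes the radius uniform. *)
Lemma clopen_lebesgue_number (R : realType) (Y : pseudoMetricType R)
    (B : set Y) : compact [set: Y] -> clopen B ->
  exists2 e : R, 0 < e & forall y z, ball y e z -> B y <-> B z.
Proof.
move=> cptY [oB cB].
have loc (C : set Y) y : open C -> C y ->
    \forall y' \near y & e \near 0^'+, forall z, ball y' e z -> C y' /\ C z.
  move=> oC Cy; have /nbhs_ballP[r /= r0 rC] : nbhs y C.
    exact: open_nbhs_nbhs.
  exists (ball y (r / 2), [set e : R | e < r / 2]).
    split; first by apply: nbhsx_ballx; rewrite divr_gt0.
    by apply: nbhs_right_lt; rewrite divr_gt0.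
  move=> [y' e] /= [yy' er] z y'z; split; apply: rC.
    by apply: le_ball yy'; rewrite ler_pdivrMr// ler_pMr// ler1n.
  rewrite [r]splitr; apply: ball_triangle yy' _.
  exact: le_ball (ltW er) _ y'z.
have cover y : [set: Y] y ->
    \forall y' \near y & e \near 0^'+, forall z, ball y' e z -> B y' <-> B z.
  move=> _; have [By|nBy] := pselect (B y).
    by apply: filterS (loc _ _ oB By) => -[y' e] /= h z /h[].
  have oB' : open (~` B) by rewrite openC.
  by apply: filterS (loc _ _ oB' nBy) => -[y' e] /= h z /h[].
pose P (e : R) y := forall z, ball y e z -> B y <-> B z.
have nearP := (compact_near_coveringP _).1 cptY R (0^'+) P _ cover.
near (0:R)^'+ => e; exists e => // y z.
by have /(_ y I z) : [set: Y] `<=` P e by near: e; exact: nearP.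
Unshelve. all: by end_near. Qed.

Lemma continuous_bijection_homeomorphism (X Y : topologicalType) (f : X -> Y) :
  compact [set: X] -> hausdorff_space Y -> continuous f -> injective f ->
  (forall y, exists x, f x = y) -> homeomorphism f.
Proof.
move=> cptX hY cf finj /choice[g gK]; split=> //; exists g.
have fK : cancel f g by move=> x; exact/finj/gK.
split=> //; apply/continuous_closedP => A cA.
have -> : g @^-1` A = f @` A.
  apply/seteqP; split=> [y Agy|_ [x Ax <-]]; first by exists (g y).
  by rewrite /= fK.
apply: compact_closed => //; apply: continuous_compact.
  exact: continuous_subspaceT.
exact: subclosed_compact cptX _.
Qed.

Lemma clopen_base (T : topologicalType) (x : T) (U : set T) :
  cantor_like T -> nbhs x U -> exists2 C, clopen C & C x /\ C `<=` U.
Proof.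
move=> [_ cptT hT zT] /(zero_dimensional_cvg hT zT cptT)[D [Dx clD] DU].
by exists D.
Qed.

(** * Borel measures and clopen sets *)

Lemma borel_open (R : realType) (X : pmetricType R) (A : set (borel X)) :
  open (A : set X) -> measurable A.
Proof. exact: sub_sigma_algebra. Qed.

Lemma borel_clopen (R : realType) (X : pmetricType R) (A : set (borel X)) :
  clopen (A : set X) -> measurable A.
Proof. by move=> [oA _]; exact: borel_open. Qed.

Lemma continuous_measurable_borel (R : realType) (X Y : pmetricType R)
    (T : X -> Y) : continuous T ->
  measurable_fun [set: borel X] (T : borel X -> borel Y).
Proof.
move=> /continuousP cT.
apply: (@measurability _ _ (borel X) (borel Y) setT T (@open Y)) => //.
move=> _ [B oB <-]; rewrite setTI; apply: borel_open; exact: cT.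
Qed.

Lemma open_bigcup_clopen (R : realType) (Y : pmetricType R) (U : set Y) :
  cantor_like Y -> open U ->
  exists2 F : nat -> set Y, forall n, clopen (F n) & U = \bigcup_n F n.
Proof.
move=> cY oU; have [_ cptY _ _] := cY.
have C := unsquash (clopen_surj cptY).
(* [C] enumerates all clopen sets; those not inside [U] become empty and add nothing to the
   union. *)
exists (fun n => if `[< C n `<=` U >] then C n else set0).
  move=> n; case: asboolP => _; last exact: clopen0.
  exact: (@funS _ _ _ _ C n I).
apply/seteqP; split => [y Uy|y [n _]]; last by case: asboolP => // CU /CU.
have [D clD [Dy DU]] := clopen_base cY (open_nbhs_nbhs (conj oU Uy)).
have [n _ CnD] : range C D by exact: (@surj _ _ _ _ C).
by exists n => //; rewrite CnD; case: asboolP.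
Qed.

Lemma borel_generated_clopen (R : realType) (Y : pmetricType R) :
  cantor_like Y ->
  (@measurable _ (borel Y) : set (set Y)) = <<s (@clopen Y) >>.
Proof.
move=> cY; apply/seteqP; split.
  apply: smallest_sub; first exact: smallest_sigma_algebra.
  move=> U oU; have [F clF ->] := open_bigcup_clopen cY oU.
  have [_ _ bigF] := smallest_sigma_algebra setT (@clopen Y).
  by apply: bigF => n; apply: sub_sigma_algebra; exact: clF.
apply: smallest_sub; first exact: sigma_algebra_measurable.
by move=> A clA; exact: borel_clopen.
Qed.

(** The pushforward [m] of [mu] agrees with [nu] on the clopen sets, a pi-system that generates the
    Borel sets and contains the whole space, where both are finite. *)
Lemma clopen_measure_preserving (R : realType) (X Y : pmetricType R)
    (mu : {finite_measure set (borel X) -> \bar R})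
    (nu : {finite_measure set (borel Y) -> \bar R}) (T : X -> Y) :
  cantor_like Y -> continuous T ->
  (forall B : set Y, clopen B -> mu (T @^-1` B) = nu B) ->
  forall B : set (borel Y), measurable B -> mu (T @^-1` B) = nu B.
Proof.
move=> cY cT TB B mB.
have mT := continuous_measurable_borel cT.
pose m :=
  measure_function_pushforward__canonical__measure_function_Measure mu mT.
apply: (@measure_unique _ R (borel Y) (@clopen Y) (fun=> setT)
  _ _ _ _ m nu _ _ B mB).
- exact: borel_generated_clopen.
- exact: clopenI.
- by move=> _; exact: clopenT.
- by rewrite bigcup_const//; exists 0%N.
- exact: TB.
- move=> _; rewrite /= /pushforward preimage_setT.
  exact: fin_num_fun_lty (fin_num_measure mu).
Qed.

Lemma clopen_measureU (R : realType) (X : pmetricType R)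
    (mu : {finite_measure set (borel X) -> \bar R}) (A B : set X) :
  clopen A -> clopen B -> A `&` B = set0 -> mu (A `|` B) = (mu A + mu B)%E.
Proof.
move=> clA clB AB0.
by apply: (@measureU _ R (borel X) mu A B) => //; exact: borel_clopen.
Qed.

Lemma clopen_measureD (R : realType) (X : pmetricType R)
    (mu : {finite_measure set (borel X) -> \bar R}) (A B : set X) :
  clopen A -> clopen B -> mu (A `\` B) = (mu A - mu (A `&` B))%E.
Proof.
move=> clA clB.
apply: (@measureD _ (borel X) R mu A B); try exact: borel_clopen.
by rewrite ltey_eq fin_num_measure//; exact: borel_clopen.
Qed.

(** * Atoms of a finite list of sets *)

Definition bits (T : Type) (s : seq (set T)) (x : T) : seq bool :=
  [seq `[< A x >] | A <- s].

(** The nonempty cells are the atoms of the Boolean algebra generated by [s], indexed by membership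
    patterns. *)
Definition cell (T : Type) (s : seq (set T)) (b : seq bool) : set T :=
  [set x | bits s x = b].

Lemma nth_bits (T : Type) (s : seq (set T)) (x : T) i :
  nth false (bits s x) i = `[< nth set0 s i x >].
Proof.
have [lt_is|le_si] := ltnP i (size s); first by rewrite (nth_map set0).
by rewrite !nth_default ?size_map//; apply/esym/asboolP.
Qed.

Lemma eq_bits (S T : Type) (s : seq (set S)) (t : seq (set T)) x y i :
  bits s x = bits t y -> nth set0 s i x <-> nth set0 t i y.
Proof.
move=> /(congr1 (nth false ^~ i)); rewrite !nth_bits => e.
by split => /asboolP; [rewrite e|rewrite -e] => /asboolP.
Qed.

Lemma bits_cat (T : Type) (s t : seq (set T)) x :
  bits (s ++ t) x = bits s x ++ bits t x.
Proof. exact: map_cat. Qed.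

Lemma size_bits (T : Type) (s : seq (set T)) x : size (bits s x) = size s.
Proof. exact: size_map. Qed.

Lemma cell_nil (T : Type) : cell [::] [::] = [set: T].
Proof. by apply/seteqP; split. Qed.

Lemma cell_size (T : Type) (s : seq (set T)) b :
  size s != size b -> cell s b = set0.
Proof.
move=> sb; apply/seteqP; split=> // x /= xb.
by rewrite -xb size_bits eqxx in sb.
Qed.

Lemma cell_cons (T : Type) (A : set T) s c b :
  cell (A :: s) (c :: b) = (if c then A else ~` A) `&` cell s b.
Proof.
apply/seteqP; split=> x.
  by move=> [<- <-]; case: asboolP.
move=> [Ac xb]; rewrite /cell /= -[X in _ = _ :: X]xb; congr (_ :: _).
by case: c Ac => Ac; apply/asboolP.
Qed.

Lemma clopen_cell (T : topologicalType) (s : seq (set T)) b :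
  (forall i, clopen (nth set0 s i)) -> clopen (cell s b).
Proof.
elim: s b => [|A s ih] [|c b] cls.
- by rewrite cell_nil; exact: clopenT.
- by rewrite cell_size//; exact: clopen0.
- by rewrite cell_size//; exact: clopen0.
have clA := cls 0%N.
rewrite cell_cons; apply: clopenI; last by apply: ih => i; exact: (cls i.+1).
by case: c => //; exact: clopenC.
Qed.

(** * Transfer of clopen sets between matched lists *)

Section matching.
Context {R : realType}.

(** Equal measures of cells make the correspondence of positions a measure preserving isomorphism of
    finite Boolean algebras, up to null cells. Out of range, [nth] returns the clopen set [set0]. *)
Definition matched (X Y : pmetricType R)
    (mu : {finite_measure set (borel X) -> \bar R})
    (nu : {finite_measure set (borel Y) -> \bar R})
    (s : seq (set X)) (t : seq (set Y)) :=
  [/\ size s = size t,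
      forall i, clopen (nth set0 s i) /\ clopen (nth set0 t i),
      forall i, mu (nth set0 s i) = nu (nth set0 t i) &
      forall b, mu (cell s b) = nu (cell t b)].

Lemma matched_sym (X Y : pmetricType R)
    (mu : {finite_measure set (borel X) -> \bar R})
    (nu : {finite_measure set (borel Y) -> \bar R}) s t :
  matched mu nu s t -> matched nu mu t s.
Proof. by move=> [st cl e eb]; split=> // i; have [] := cl i. Qed.

(** Equality of the clopen values sets realizes the measure of [P]&[C] by some clopen set of [Y];
    goodness then moves it inside [Q], whose measure is at least as large. *)
Lemma good_transfer (X Y : pmetricType R)
    (mu : {finite_measure set (borel X) -> \bar R})
    (nu : {finite_measure set (borel Y) -> \bar R})
    (P C : set X) (Q : set Y) :
  good nu -> clopen_values mu = clopen_values nu ->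
  clopen P -> clopen Q -> clopen C -> mu P = nu Q ->
  exists D, [/\ clopen D, D `<=` Q & nu D = mu (P `&` C)].
Proof.
move=> gnu S_eq clP clQ clC PQ.
have clPC : clopen (P `&` C) by exact: clopenI.
have [E clE EE] : clopen_values nu (mu (P `&` C)).
  by rewrite -S_eq; exists (P `&` C).
have [|D [clD DQ DE]] := gnu E Q clE clQ; last by exists D; rewrite DE.
rewrite EE -PQ; apply: le_measure; rewrite ?inE//; exact: borel_clopen.
Qed.

(* Goodness only gives a clopen subset of prescribed measure, so the trace of
   [C] on each cell of [s] is transferred separately. *)
Lemma matched_transfer (X Y : pmetricType R)
    (mu : {finite_measure set (borel X) -> \bar R})
    (nu : {finite_measure set (borel Y) -> \bar R})
    (s : seq (set X)) (t : seq (set Y)) (P C : set X) (Q : set Y) :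
  good nu -> clopen_values mu = clopen_values nu -> size s = size t ->
  (forall i, clopen (nth set0 s i) /\ clopen (nth set0 t i)) ->
  clopen P -> clopen Q -> clopen C ->
  (forall b, mu (P `&` cell s b) = nu (Q `&` cell t b)) ->
  exists D, [/\ clopen D, D `<=` Q, nu D = mu (P `&` C) &
    forall b, mu ((P `&` C) `&` cell s b) = nu (D `&` cell t b)].
Proof.
move=> gnu S_eq; elim: s t P Q => [|A s ih] [|B t]// P Q st cl clP clQ clC PQ.
  have [|D [clD DQ DE]] := good_transfer gnu S_eq clP clQ clC.
    by have := PQ [::]; rewrite !cell_nil !setIT.
  exists D; split=> // -[|c b]; first by rewrite !cell_nil !setIT.
  by rewrite !cell_size// !setI0 !measure0.
have [clA clB] := cl 0%N.
have cl' i := cl i.+1.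
have [st'] := st.
have clAC := clopenC set0 clA; have clBC := clopenC set0 clB.
(* The induction cuts [P] along [A] and [Q] along [B]. A cell of the longer list inside [P] is a
   cell of the shorter one inside a half of [P], so the hypothesis on cells passes to both
   halves. *)
have [b|D1 [clD1 D1Q D1E D1b]] := ih t (P `&` A) (Q `&` B) st' cl'
    (clopenI clP clA) (clopenI clQ clB) clC.
  by have := PQ (true :: b); rewrite !cell_cons !setIA.
have [b|D2 [clD2 D2Q D2E D2b]] := ih t (P `&` ~` A) (Q `&` ~` B) st' cl'
    (clopenI clP clAC) (clopenI clQ clBC) clC.
  by have := PQ (false :: b); rewrite !cell_cons !setIA.
exists (D1 `|` D2); split.
- exact: clopenU.
- by rewrite subUset; split=> y; [move=> /D1Q[]|move=> /D2Q[]].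
- rewrite clopen_measureU//; last first.
    by apply/seteqP; split=> // y [/D1Q[_ ?] /D2Q[_ ?]].
  rewrite D1E D2E -clopen_measureU; [|exact: clopenI (clopenI _ _) _ ..|].
    by rewrite -setIUl -setIUr setUv setIT.
  by apply/seteqP; split=> // x [[[_ ?] _] [[_ ?] _]].
- move=> [|c b]; first by rewrite !cell_size// !setI0 !measure0.
  rewrite !cell_cons !setIA; case: c.
    (* [D1] lies in [B] and [D2] outside it, so the union of the two meets [B] exactly in [D1], and
       its complement exactly in [D2]. *)
    rewrite [P `&` C `&` A]setIAC D1b; congr (nu (_ `&` _)).
    apply/seteqP; split=> y.
      by move=> D1y; split; [left|case: (D1Q _ D1y)].
    by move=> [[//|/D2Q[_ ?]]].
  rewrite [P `&` C `&` _]setIAC D2b; congr (nu (_ `&` _)).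
  apply/seteqP; split=> y.
    by move=> D2y; split; [right|case: (D2Q _ D2y)].
  by move=> [[/D1Q[_ ?]|//]].
Qed.

Lemma matched_cons (X Y : pmetricType R)
    (mu : {finite_measure set (borel X) -> \bar R})
    (nu : {finite_measure set (borel Y) -> \bar R})
    (s : seq (set X)) (t : seq (set Y)) (C : set X) :
  good nu -> clopen_values mu = clopen_values nu -> matched mu nu s t ->
  clopen C -> exists D, matched mu nu (C :: s) (D :: t).
Proof.
move=> gnu S_eq [st cl nth_st cell_st] clC.
have [b|D [clD _ DC Db]] :=
    matched_transfer gnu S_eq st cl clopenT clopenT clC.
  by rewrite !setTI.
rewrite !setTI in DC Db.
exists D; split => [|[|i]|[|i]|[|c b]] //=.
- by rewrite st.
- by rewrite !cell_size// !measure0.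
rewrite !cell_cons; case: c; first exact: Db.
have cls : clopen (cell s b) by apply: clopen_cell => i; case: (cl i).
have clt : clopen (cell t b) by apply: clopen_cell => i; case: (cl i).
(* A cell outside the new set is an old cell minus its trace on that set, and finite measures may be
   subtracted. *)
rewrite setIC -setDE [~` D `&` _]setIC -setDE !clopen_measureD//.
by rewrite setIC [in RHS]setIC cell_st Db.
Qed.

End matching.

(** * Back-and-forth construction of an isomorphism *)

Section back_and_forth.
Context {R : realType} (X Y : pmetricType R).
Variables (mu : {finite_measure set (borel X) -> \bar R})
          (nu : {finite_measure set (borel Y) -> \bar R}).
Hypotheses (cX : cantor_like X) (cY : cantor_like Y).
Hypotheses (full_mu : full mu) (full_nu : full nu).
Hypotheses (good_mu : good mu) (good_nu : good nu).
Hypothesis S_eq : clopen_values mu = clopen_values nu.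

(** New sets are prepended in equal number on both sides, so the bits of an earlier stage are a
    suffix of those of a later one. *)
Let refines (st st' : seq (set X) * seq (set Y)) :=
  exists u v, [/\ size u = size v, st'.1 = u ++ st.1 & st'.2 = v ++ st.2].

(** One step forth finds a partner [D1] for [C]; one step back, with the two spaces exchanged, finds
    a partner [C1] for [D]. *)
Lemma matched_refine (C : set X) (D : set Y) st :
  clopen C -> clopen D -> matched mu nu st.1 st.2 ->
  exists st', [/\ matched mu nu st'.1 st'.2, refines st st',
    exists i, nth set0 st'.1 i = C & exists i, nth set0 st'.2 i = D].
Proof.
move=> clC clD m.
have [D1 m1] := matched_cons good_nu S_eq m clC.
have [C1 m2] := matched_cons good_mu (esym S_eq) (matched_sym m1) clD.
exists ([:: C1, C & st.1], [:: D, D1 & st.2]); split => /=.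
- exact: matched_sym.
- by exists [:: C1; C], [:: D; D1].
- by exists 1%N.
- by exists 0%N.
Qed.

Lemma matched_sequence s t : matched mu nu s t ->
  exists st : nat -> seq (set X) * seq (set Y),
  [/\ st 0%N = (s, t), forall n, matched mu nu (st n).1 (st n).2,
      forall n, refines (st n) (st n.+1),
      forall C, clopen C -> exists n i, nth set0 (st n).1 i = C &
      forall D, clopen D -> exists n i, nth set0 (st n).2 i = D].
Proof.
move=> m0; have [_ cptX _ _] := cX; have [_ cptY _ _] := cY.
have C := unsquash (clopen_surj cptX).
have D := unsquash (clopen_surj cptY).
have clC n : clopen (C n) by exact: (@funS _ _ _ _ C n I).
have clD n : clopen (D n) by exact: (@funS _ _ _ _ D n I).
(* The hypothesis [matched] stands under the existential so that choice yields a total [f]; on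
   unmatched lists its value is arbitrary. *)
have /choice[f fP] : forall p : nat * (seq (set X) * seq (set Y)),
    exists st', matched mu nu p.2.1 p.2.2 ->
    [/\ matched mu nu st'.1 st'.2, refines p.2 st',
      exists i, nth set0 st'.1 i = C p.1 & exists i, nth set0 st'.2 i = D p.1].
  move=> [n st]; have [mst|nmst] := pselect (matched mu nu st.1 st.2).
    by have [st' ?] := matched_refine (clC n) (clD n) mst; exists st'.
  by exists st.
pose st := fix st n := if n is n'.+1 then f (n', st n') else (s, t).
have mst n : matched mu nu (st n).1 (st n).2.
  by elim: n => // n ih; have [] := fP (n, st n) ih.
exists st; split=> // [n|A clA|B clB].
- by have [] := fP (n, st n) (mst n).
- have [n _ <-] : range C A by exact: (@surj _ _ _ _ C).
  by have [_ _ Ci _] := fP (n, st n) (mst n); exists n.+1.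
- have [n _ <-] : range D B by exact: (@surj _ _ _ _ D).
  by have [_ _ _ Di] := fP (n, st n) (mst n); exists n.+1.
Qed.

End back_and_forth.

(* [y] lies in the intersection of a decreasing sequence of nonempty clopen
   cells. *)
Lemma exists_same_bits (R : realType) (X Y : pmetricType R)
    (mu : {finite_measure set (borel X) -> \bar R})
    (nu : {finite_measure set (borel Y) -> \bar R})
    (s : nat -> seq (set X)) (t : nat -> seq (set Y)) :
  compact [set: Y] -> full mu ->
  (forall n, matched mu nu (s n) (t n)) ->
  (forall n, exists u v, [/\ size u = size v, s n.+1 = u ++ s n &
     t n.+1 = v ++ t n]) ->
  forall x, exists y, forall n, bits (s n) x = bits (t n) y.
Proof.
move=> cptY full_mu m ext x.
have cell_ne n : exists y, bits (s n) x = bits (t n) y.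
  have [_ cl _ eb] := m n.
  (* The cell of [x] is open and nonempty, hence of positive measure; so is the matching cell of
     [Y], which therefore has a point. *)
  have : (0 < mu (cell (s n) (bits (s n) x)))%E.
    apply: full_mu; last by exists x.
    by have [] : clopen (cell (s n) (bits (s n) x))
      by apply: clopen_cell => i; case: (cl i).
  rewrite eb; apply: contraPP => /forallNP ne.
  rewrite (_ : cell _ _ = set0) ?measure0 ?ltxx//.
  by apply/seteqP; split=> // y /esym /ne.
have [y_ yP] := choice cell_ne.
have dec n k y : bits (s (k + n)%N) x = bits (t (k + n)%N) y ->
    bits (s n) x = bits (t n) y.
  elim: k => // k ih; have [u [v [uv -> ->]]] := ext (k + n)%N.
  by rewrite !bits_cat => /eqP; rewrite eqseq_cat ?size_bits// => /andP[_ /eqP].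
(* A cluster point of [y_] lies in the cell of every stage [n], because this cell is closed and
   contains [y_ k] for all [k >= n]. *)
have [y [_ cly]] := cptY (y_ @ \oo) _ filterT.
exists y => n; have [_ cl _ _] := m n.
have clE : closed (cell (t n) (bits (s n) x)).
  by have [] : clopen (cell (t n) (bits (s n) x))
    by apply: clopen_cell => i; case: (cl i).
apply/esym; apply: clE => U yU; apply: cly => //.
exists n => // k /= nk; apply/esym/(dec _ (k - n)%N); rewrite subnK//.
Qed.

(** [T] sends [x] to a point with the same bits at every stage. Every clopen set of either space is
    eventually listed and clopen sets separate points, so bits determine points, and preimages of
    clopen sets are clopen of the same measure. *)
Lemma matched_isomorphism (R : realType) (X Y : pmetricType R)
    (mu : {finite_measure set (borel X) -> \bar R})
    (nu : {finite_measure set (borel Y) -> \bar R})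
    (s : seq (set X)) (t : seq (set Y)) :
  cantor_like X -> cantor_like Y -> full mu -> full nu -> good mu -> good nu ->
  clopen_values mu = clopen_values nu -> matched mu nu s t ->
  exists T : X -> Y, [/\ CS mu nu T, homeomorphism T &
    forall x, bits s x = bits t (T x)].
Proof.
move=> cX cY full_mu full_nu good_mu good_nu S_eq m.
have [st [st0 mst ref allX allY]] :=
  matched_sequence cX cY good_mu good_nu S_eq m.
have [_ cptX hX zX] := cX; have [_ cptY hY zY] := cY.
have exY := exists_same_bits cptY full_mu mst ref.
have exX := exists_same_bits cptX full_nu (fun n => matched_sym (mst n)).
have {}/exX exX : forall n, exists u v, [/\ size u = size v,
    (st n.+1).2 = u ++ (st n).2 & (st n.+1).1 = v ++ (st n).1].
  by move=> n; have [u [v [uv e1 e2]]] := ref n; exists v, u.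
have [T TP] := choice exY.
have Tpre n i : T @^-1` (nth set0 (st n).2 i) = nth set0 (st n).1 i.
  by apply/seteqP; split=> x; have [] := eq_bits i (TP x n).
have injT : injective T.
  move=> x x' Txx'; apply: contrapT => /eqP /zX[U [clU Ux]]; apply.
  have [n [i Ui]] := allX U clU; move: Ux; rewrite -Ui -Tpre /=.
  by rewrite Txx'.
have surjT y : exists x, T x = y.
  have [x xP] := exX y; exists x.
  apply: contrapT => /eqP /zY[U [clU UTx]]; apply.
  have [n [i Ui]] := allY U clU; move: UTx; rewrite -Ui.
  have : bits (st n).2 (T x) = bits (st n).2 y by rewrite -TP xP.
  by move=> /(eq_bits i)[].
have cT : continuous T.
  move=> x U /= /(clopen_base cY)[C clC [Cx CU]].
  have [n [i Ci]] := allY C clC.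
  have [_ cl _ _] := mst n; have [[oA _] _] := cl i.
  have : nbhs x (T @^-1` C).
    by rewrite -Ci Tpre; apply: open_nbhs_nbhs; split => //; rewrite -Tpre Ci.
  by apply: filterS => z /CU.
exists T; split.
- split => //; apply: clopen_measure_preserving => // B clB.
  have [n [i Bi]] := allY B clB; rewrite -Bi Tpre.
  by have [_ _ -> _] := mst n.
- exact: continuous_bijection_homeomorphism.
- by move=> x; have := TP x 0%N; rewrite st0.
Qed.

(** * Density and the countable intersection of open sets *)

Lemma clopen_mesh (R : realType) (Y : pmetricType R) (e : R) :
  cantor_like Y -> 0 < e ->
  exists t : seq (set Y), (forall i, clopen (nth set0 t i)) /\
    forall y z, bits t y = bits t z -> ball y e z.
Proof.
move=> cY e0; have [_ cptY _ _] := cY.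
have /choice[D DP] y :
    exists D : set Y, [/\ clopen D, D y & D `<=` ball y (e / 2)].
  have [|D clD [Dy DU]] := clopen_base cY (nbhsx_ballx y (e / 2) _).
    by rewrite divr_gt0.
  by exists D.
have [F' _ cov] : finite_subset_cover [set: Y] D [set: Y].
  move: cptY; rewrite compact_cover; apply.
    by move=> y _; have [[]] := DP y.
  by move=> y _; exists y => //; have [] := DP y.
pose F : seq Y := finmap.enum_fset F'.
exists [seq D y | y <- F]; split.
  move=> i; have [lt_i|le_i] := ltnP i (size F).
    by rewrite (nth_map point)//; have [] := DP (nth point F i).
  by rewrite nth_default ?size_map//; exact: clopen0.
(* Equal bits put [z] in the same member [D w] of the cover as [y], and [D w] has radius at most
   [e / 2] around [w]. *)
move=> y z yz; have [w /= wF Dwy] := cov y I.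
have := eq_bits (index w F) yz.
have wF' : w \in F by exact: wF.
rewrite (nth_map point) ?index_mem// nth_index// => -[/(_ Dwy) Dwz _].
have [_ _ Dw] := DP w; rewrite [e]splitr.
by apply: ball_triangle (Dw _ Dwz); apply/ball_sym/Dw.
Qed.

Section CS.
Context {R : realType} (X Y : pmetricType R).
Variables (mu : {finite_measure set (borel X) -> \bar R})
          (nu : {finite_measure set (borel Y) -> \bar R}).

(** The range is compact, hence closed; its complement is open with empty preimage, so it is null
    and, by fullness, empty. *)
Lemma CS_surjective (T : X -> Y) : compact [set: X] -> full nu ->
  CS mu nu T -> forall y, exists x, T x = y.
Proof.
move=> cptX full_nu [cT mT] y; apply: contrapT => /forallNP ny.
have oU : open (~` range T).
  rewrite openC; apply: compact_closed; first exact: metric_hausdorff.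
  by apply: continuous_compact => //; exact: continuous_subspaceT.
have : (0 < nu (~` range T))%E.
  by apply: full_nu => //; exists y => -[x _]; exact: ny.
rewrite -mT; last exact: borel_open.
rewrite (_ : _ @^-1` _ = set0) ?measure0 ?ltxx//.
by apply/seteqP; split=> // x /=; apply; exists x.
Qed.

Lemma CSiso_dense :
  cantor_like X -> cantor_like Y -> full mu -> full nu -> good mu -> good nu ->
  clopen_values mu = clopen_values nu -> dense (CSiso mu nu).
Proof.
move=> cX cY full_mu full_nu good_mu good_nu S_eq O [T OT] oO.
have [e e0 eO] := (nbhs_subtype_uniform T O).1 (open_nbhs_nbhs (conj oO OT)).
have [t [clt tP]] := clopen_mesh cY e0.
have [cT mT] : CS mu nu (set_val T) := set_valP T.
pose f : X -> Y := set_val T.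
pose s := [seq f @^-1` B | B <- t].
have sE i : nth set0 s i = f @^-1` (nth set0 t i).
  have [lt_i|le_i] := ltnP i (size t); first by rewrite (nth_map set0).
  by rewrite !nth_default ?size_map// preimage_set0.
have bitsE x : bits s x = bits t (f x) by rewrite /bits /s -map_comp.
have m : matched mu nu s t.
  split=> [|i|i|b]; first by rewrite size_map.
  - by split=> //; rewrite sE; exact: preimage_clopen.
  - by rewrite sE mT//; exact: borel_clopen.
  - rewrite -mT; last by apply: borel_clopen; exact: clopen_cell.
    congr (mu _); apply/seteqP; split=> x /=; by rewrite /cell /= bitsE.
have [S [CSS hS SE]] :=
  matched_isomorphism cX cY full_mu full_nu good_mu good_nu S_eq m.
exists (exist _ (S : {uniform X -> Y}) (mem_set CSS) : CS mu nu); split.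
  (* [S x] and [T x] have the same bits for [t], so the mesh property bounds their distance
     uniformly in [x]. *)
  by apply: eO => x; apply: tP; rewrite -[LHS]bitsE SE.
exact: hS.
Qed.

Lemma CSiso_Gdelta :
  cantor_like X -> cantor_like Y -> full nu ->
  Gdelta (CSiso mu nu).
Proof.
move=> cX cY full_nu; have [_ cptX _ zX] := cX; have [_ cptY hY _] := cY.
have C := unsquash (clopen_surj cptX).
have clC n : clopen (C n) by exact: (@funS _ _ _ _ C n I).
exists (fun n => [set T | forall x y, C n x -> ~ C n y ->
    (set_val T : X -> Y) x != (set_val T : X -> Y) y]).
  move=> n; rewrite openE => T nT; apply/nbhs_subtype_uniform.
  have [cT _] : CS mu nu (set_val T) := set_valP T.
  pose f : X -> Y := set_val T.
  have cptC : compact (C n `*` ~` C n).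
    have [oC cC] := clC n.
    apply: compact_setX; apply: subclosed_compact cptX _ => //.
    by rewrite closedC.
  (* No perturbation of [f] by less than [e] can identify the two points of a pair satisfying [P e].
     Compactness of [C n] times its complement gives one [e] for all pairs. *)
  pose P (e : R) (p : X * X) := forall z w,
    ball (f p.1) e z -> ball (f p.2) e w -> z != w.
  have cover p : (C n `*` ~` C n) p -> \forall q \near p & e \near 0^'+, P e q.
    case: p => x y [/= Cx nCy].
    have := hY; rewrite ball_hausdorff => /(_ _ _ (nT x y Cx nCy)).
    move=> [[r1 r2]] /= /eqP r12.
    have near_ball (u : X) (r : {posnum R}) :
        \forall u' \near u & e \near 0^'+, ball (f u') e `<=` ball (f u) r%:num.
      exists (f @^-1` ball (f u) (r%:num / 2), [set e : R | e < r%:num / 2]).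
        split; last exact: nbhs_right_lt.
        exact/cT/nbhsx_ballx.
      move=> [u' e] /= [uu' er] z u'z; rewrite [r%:num]splitr.
      exact: ball_triangle uu' (le_ball (ltW er) u'z).
    have [[U1 E1] [/= xU1 E10] UE1] := near_ball x r1.
    have [[U2 E2] [/= yU2 E20] UE2] := near_ball y r2.
    exists (U1 `*` U2, E1 `&` E2) => /=.
      by split; [exists (U1, U2)|exact: filterI].
    move=> [[x' y'] e] /= [[U1x' U2y'] [E1e E2e]] z w /= xz yw.
    apply/eqP => zw; rewrite -zw in yw.
    suff : (ball (f x) r1%:num `&` ball (f y) r2%:num) z by rewrite r12.
    by split; [exact: (UE1 (x', e))|exact: (UE2 (y', e))].
  have nearP := (compact_near_coveringP _).1 cptC R (0^'+) P _ cover.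
  near (0 : R)^'+ => e; exists e => // S TS x y Cx nCy.
  have CP : C n `*` ~` C n `<=` P e by near: e; exact: nearP.
  exact: (CP (x, y) (conj Cx nCy) _ _ (TS x) (TS y)).
apply/seteqP; split.
  move=> T [cT [g [_ gK _]]] n _ x y Cx nCy.
  by apply/eqP => /(can_inj gK) xy; rewrite xy in Cx.
move=> T FT; have CST : CS mu nu (set_val T) := set_valP T.
have [cT _] := CST.
apply: continuous_bijection_homeomorphism => //; last exact: CS_surjective CST.
(* Distinct points are separated by a clopen set, which is some [C n]. *)
move=> x y Txy; apply: contrapT => /eqP /zX[U [clU Ux Uy]].
have [n _ Un] : range C U by exact: (@surj _ _ _ _ C).
have := FT n I x y; rewrite Un => /(_ Ux Uy); by rewrite Txy eqxx.
Unshelve. all: by end_near. Qed.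

End CS.

(** * The sup metric *)

Lemma compact_mdist_bounded (R : realType) (Y : metricType R) :
  compact [set: Y] -> exists b : R, forall y z : Y, mdist y z <= b.
Proof.
move=> cptY; have [[y0 _]|ne] := pselect ([set: Y] !=set0); last first.
  by exists 0 => y; exfalso; apply: ne; exists y.
have cover y : [set: Y] y ->
    \forall z \near y & b \near +oo, mdist y0 z <= b.
  move=> _; exists (ball y 1, [set b : R | mdist y0 y + 1 <= b]).
    by split; [exact: nbhsx_ballx|by apply: nbhs_pinfty_ge; exact: num_real].
  move=> [z b] /=; rewrite ballEmdist /= => -[yz yb]; apply: le_trans yb.
  by rewrite (le_trans (metric_triangle _ y _))// lerD2l ltW.
have bP := (compact_near_coveringP _).1 cptY R +oo (fun b z => mdist y0 z <= b)
  _ cover.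
near (+oo : set_system R) => b; exists (b + b) => y z.
have bd w : mdist y0 w <= b.
  have : [set: Y] `<=` (fun z => mdist y0 z <= b) by near: b; exact: bP.
  exact.
by rewrite (le_trans (metric_triangle _ y0 _))// lerD// metric_sym.
Unshelve. all: by end_near. Qed.

Section sup_metric.
Context {R : realType} (X : pointedType) (Y : metricType R).
Implicit Types f g h : X -> Y.

(** For compact [Y] this is a genuine supremum: distances are bounded, and the base point of [X]
    makes the set nonempty. *)
Definition sup_dist f g := sup [set mdist (f x) (g x) | x in [set: X]].

Hypothesis cptY : compact [set: Y].

Lemma mdist_sup_dist f g x : mdist (f x) (g x) <= sup_dist f g.
Proof.
have [b bP] := compact_mdist_bounded cptY.
apply: ub_le_sup; last by exists x.
by exists b => _ [z _ <-].
Qed.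

Lemma sup_dist_le f g c :
  (forall x, mdist (f x) (g x) <= c) -> sup_dist f g <= c.
Proof.
move=> fg; apply: ge_sup; first by exists (mdist (f point) (g point)), point.
by move=> _ [x _ <-].
Qed.

Lemma sup_distxx f : sup_dist f f = 0.
Proof.
apply/eqP; rewrite eq_le sup_dist_le => [|x]; last by rewrite mdistxx.
by rewrite (le_trans _ (mdist_sup_dist f f point))// mdistxx.
Qed.

Lemma sup_dist_positivity f g : sup_dist f g = 0 -> f = g.
Proof.
move=> fg0; apply/funext => x; apply: mdist_positivity; apply/eqP.
by rewrite eq_le mdist_ge0 andbT -fg0 mdist_sup_dist.
Qed.

Lemma sup_dist_sym f g : sup_dist f g = sup_dist g f.
Proof.
by congr (sup _); apply: eq_imagel => x _; exact: metric_sym.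
Qed.

Lemma sup_dist_triangle g f h : sup_dist f h <= sup_dist f g + sup_dist g h.
Proof.
apply: sup_dist_le => x; rewrite (le_trans (metric_triangle _ (g x) _))//.
by rewrite lerD// mdist_sup_dist.
Qed.

End sup_metric.

(** * Complete metrizability of the space of maps *)

Section CS_complete.
Context {R : realType} (X Y : pmetricType R).
Variables (mu : {finite_measure set (borel X) -> \bar R})
          (nu : {finite_measure set (borel Y) -> \bar R}).

Lemma CS_uniform_limit (T : X -> Y) : cantor_like Y ->
  (forall e : R, 0 < e -> exists S : X -> Y,
    CS mu nu S /\ forall x, ball (T x) e (S x)) ->
  CS mu nu T.
Proof.
move=> cY TP; have [_ cptY _ _] := cY.
have cT : continuous T.
  move=> x U /= /nbhs_ballP[e /= e0 eU].
  have e30 : 0 < e / 3 by rewrite divr_gt0.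
  have [S [[cS _] TS]] := TP _ e30.
  have : nbhs x (S @^-1` ball (S x) (e / 3)) by exact/cS/nbhsx_ballx.
  apply: filterS => z /= Sxz; apply: eU.
  have -> : e = e / 3 + e / 3 + e / 3 by lra.
  by apply: ball_triangle (ball_sym (TS z)); exact: ball_triangle (TS x) Sxz.
split => //; apply: clopen_measure_preserving => // B clB.
(* With [e] a Lebesgue number for [B], the preimages of [B] under [T] and [S] coincide, so no limit
   of measures is taken. *)
have [e e0 eB] := clopen_lebesgue_number cptY clB.
have [S [[_ mS] TS]] := TP _ e0.
rewrite -mS; last exact: borel_clopen.
by congr (mu _); apply/seteqP; split=> x; have [] := eB _ _ (TS x).
Qed.

(* A copy of the carrier of [CS], free of the subspace topology. *)
Definition CS_carrier : Type := CS mu nu.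
HB.instance Definition _ := Choice.on CS_carrier.

Let fn (T : CS_carrier) : X -> Y := set_val T.

Let fn_inj : injective fn.
Proof. by move=> S T; exact: val_inj. Qed.

Lemma CS_completely_metrizable :
  cantor_like Y -> completely_metrizable R (CS mu nu).
Proof.
move=> cY; have [_ cptY _ _] := cY.
pose d (S T : CS_carrier) := sup_dist (fn S) (fn T).
have dxx S : d S S = 0 by exact: sup_distxx.
have d0 S T : d S T = 0 -> S = T.
  by move=> /(sup_dist_positivity cptY)/fn_inj.
have dC S T : d S T = d T S by exact: sup_dist_sym.
have dT T S U : d S U <= d S T + d T U by exact: sup_dist_triangle.
pose M : metricType R := HB.pack CS_carrier
  (isMetric.Build R CS_carrier dxx d0 dC dT).
have ballM (S T : M) e : ball S e T = (d S T < e) :> Prop by rewrite ballEmdist.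
exists M; split.
  move=> F FF cF.
  have smallF e : 0 < e ->
      exists2 A, F A & forall S T : M, A S -> A T -> d S T < e.
    move=> e0.
    have [[A B] /= [FA FB] AB] := cF _ (entourage_ball M (PosNum e0)).
    exists (A `&` B); first exact: filterI.
    move=> S T [AS _] [_ BT].
    by have := AB (S, T) (conj AS BT); rewrite /= ballM.
  (* The candidate limit is chosen pointwise as a cluster point, which exists since [Y] is compact;
     the Cauchy property then makes the convergence uniform. *)
  have /choice[T TP] x : exists y, cluster ((fun S : M => fn S x) @ F) y.
    have [y [_ ?]] := cptY ((fun S : M => fn S x) @ F) _ filterT.
    by exists y.
  have close e : 0 < e -> exists2 A, F A &
      forall S : M, A S -> forall x, mdist (T x) (fn S x) < e.
    move=> e0; have e20 : 0 < e / 2 by rewrite divr_gt0.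
    have [A FA Ad] := smallF _ e20.
    exists A => // S AS x.
    have FA' : ((fun S : M => fn S x) @ F) [set fn S x | S in A].
      by apply: (@filterS _ F _ A) FA => S' AS'; exists S'.
    (* [S'] depends on [x], but its sup distance to [S] is controlled by [A] alone. *)
    have [_ [[S' AS' <-]]] := TP x _ _ FA' (nbhsx_ballx (T x) _ e20).
    rewrite ballEmdist /= => TS'.
    rewrite (le_lt_trans (metric_triangle _ (fn S' x) _))// [e]splitr ltrD//.
    exact: le_lt_trans (mdist_sup_dist cptY _ _ x) (Ad _ _ AS' AS).
  have CST : CS mu nu T.
    apply: CS_uniform_limit => // e e0; have [A FA AT] := close e e0.
    have [S AS] := filter_ex FA; exists (fn S); split; first exact: set_valP S.
    by move=> x; rewrite ballEmdist; exact: AT.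
  pose T' : M := exist _ (T : {uniform X -> Y}) (mem_set CST).
  exists T' => U /(@nbhs_ballP R M T' U)[e /= e0 eU].
  have e20 : 0 < e / 2 by rewrite divr_gt0.
  have [A FA AT] := close _ e20.
  apply: filterS FA => S AS; apply: eU; rewrite ballM.
  (* Passing to the supremum weakens the strict pointwise bound; the radius [e / 2] restores
     strictness. *)
  rewrite (@le_lt_trans _ _ (e / 2))//; last by lra.
  by apply: sup_dist_le => x; rewrite ltW//; exact: AT.
exists (fun T => T : CS_carrier); split.
  move=> T U /= /(@nbhs_ballP R M T U)[e /= e0 eU].
  apply/nbhs_subtype_uniform; exists (e / 2); first by rewrite divr_gt0.
  move=> S TS; apply: eU; rewrite ballM.
  rewrite (@le_lt_trans _ _ (e / 2))//; last by lra.
  by apply: sup_dist_le => x; have := TS x; rewrite ballEmdist => /ltW.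
exists (fun T => T); split=> // T U /= /nbhs_subtype_uniform[e e0 eU].
apply/(@nbhs_ballP R M T); exists e => // S; rewrite ballM => TS.
apply: eU => x.
by rewrite ballEmdist; exact: le_lt_trans (mdist_sup_dist cptY _ _ x) TS.
Qed.

End CS_complete.

Theorem theorem5p9 (R : realType) (X Y : pmetricType R)
    (mu : {finite_measure set (borel X) -> \bar R}%R)
    (nu : {finite_measure set (borel Y) -> \bar R}%R)
    (mu_cantor : cantor_measure_space mu) (nu_cantor : cantor_measure_space nu)
    (mu_good : good mu) (nu_good : good nu)
    (S_eq : clopen_values mu = clopen_values nu) :
  [/\ completely_metrizable R (CS mu nu),
      dense_Gdelta (CSiso mu nu) &
      residual (CSiso mu nu)].
Proof.
have [cX _ full_mu] := mu_cantor; have [cY _ full_nu] := nu_cantor.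
have dG : dense_Gdelta (CSiso mu nu).
  by split; [exact: CSiso_dense|exact: CSiso_Gdelta].
split; [exact: CS_completely_metrizable|exact: dG|].
by exists (CSiso mu nu).
Qed.
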